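(* Let $A$ be a finite dimensional self-injective algebra over a field and let $M$ be a finitely generated left $A$-module. Then any minimal complete resolution of $M$ is isomorphic to the complete resolution of the form $$\mathbf P\longrightarrow\boldsymbol\Sigma^{-1}\mathbf I,$$ i.e. the complex which is $\mathbf P$ in degrees $\ge0$ and $\boldsymbol\Sigma^{-1}\mathbf I$ in degrees $\le-1$, with the differential from degree $0$ to degree $-1$ equal to the composite $P_0\xrightarrow{\varepsilon}M\xrightarrow{-\eta}I_0=(\boldsymbol\Sigma^{-1}\mathbf I)_{-1}$, where $\mathbf P\xrightarrow{\varepsilon}M$ is a minimal projective resolution and $M\xrightarrow{\eta}\mathbf I=\bigoplus_{i\le0}I_i$ is a minimal injective resolution of $M$.
   Context: A finite dimensional algebra $A$ is self-injective if it is injective as a left (equivalently right) module over itself. All complexes are graded homologically (differential of degree $-1$), so an injective resolution $\mathbf I$ is placed in degrees $\le0$. The shift is $(\boldsymbol\Sigma^{i}C)_n=C_{n-i}$ with differential $(-1)^id^C$. Over self-injective $A$, a complete resolution of a finitely generated module $M$ is an acyclic chain complex $\mathbf T=(T_i,d_i)_{i\in\mathbb Z}$ of finitely generated projective $A$-modules together with a factorization $d_0=\eta_{\mathbf T}\varepsilon_{\mathbf T}$ with $\varepsilon_{\mathbf T}:T_0\to M$ surjective and $\eta_{\mathbf T}:M\to T_{-1}$ injective. A complex $C$ is minimal if every homotopy equivalence $C\to C$ is an isomorphism; a complete resolution is minimal if the complex $\mathbf T$ is minimal. A projective resolution $\mathbf P\to M$ is a minimal projective resolution if $P_n$ is a projective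 cover of $\mathrm{Coker}\,d^{\mathbf P}_{n+1}$ for all $n\ge0$; an injective resolution $M\to\mathbf I$ is a minimal injective resolution if $I_n$ is an injective envelope of $\mathrm{Ker}\,d_n^{\mathbf I}$ for all $n\le0$. *)

(* Defs.v *)
From HB Require Import structures.
From mathcomp Require Import all_boot all_algebra falgebra.
From mathcomp Require Import boolp.

Set Implicit Arguments.
Unset Strict Implicit.
Unset Printing Implicit Defensive.

Import GRing.Theory.

Local Open Scope ring_scope.
Local Open Scope quotient_scope.

Definition surj (X Y : Type) (f : X -> Y) : Prop := forall y, exists x, f x = y.

Definition finitely_generated (R : pzRingType) (M : lmodType R) : Prop :=
  exists (n : nat) (g : 'I_n -> M),
    forall x : M, exists a : 'I_n -> R, x = \sum_(i < n) a i *: g i.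

Definition projective (R : pzRingType) (P : lmodType R) : Prop :=
  forall (U V : lmodType R) (p : {linear U -> V}) (f : {linear P -> V}),
    surj p -> exists g : {linear P -> U}, forall x, p (g x) = f x.

Definition injective_module (R : pzRingType) (I : lmodType R) : Prop :=
  forall (U V : lmodType R) (i : {linear U -> V}) (f : {linear U -> I}),
    injective i -> exists g : {linear V -> I}, forall x, g (i x) = f x.

Definition self_injective (R : pzRingType) : Prop :=
  injective_module (R^o : lmodType R).

(* An epimorphism p is essential if h is onto as soon as p \o h is;
   equivalently, the kernel of p is a superfluous submodule. *)
Definition projective_cover (R : pzRingType) (P N : lmodType R)
    (p : {linear P -> N}) : Prop :=
  [/\ projective P, surj p &
      forall (X : lmodType R) (h : {linear X -> P}), surj (p \o h) -> surj h].

Definition injective_envelope (R : pzRingType) (N I : lmodType R)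
    (i : {linear N -> I}) : Prop :=
  [/\ injective_module I, injective i &
      forall (X : lmodType R) (h : {linear I -> X}),
        injective (h \o i) -> injective h].

Section KerCoker.
Variables (R : pzRingType) (U V : lmodType R) (f : {linear U -> V}).

Definition ker_pred : {pred U} := fun x => f x == 0.

Lemma ker_pred_submod : submod_closed ker_pred.
Proof.
split=> [|a x y /eqP fx0 /eqP fy0]; first exact/eqP/raddf0.
by apply/eqP; rewrite linearP fx0 fy0 scaler0 addr0.
Qed.

HB.instance Definition _ := GRing.isSubmodClosed.Build R U ker_pred
  ker_pred_submod.

Definition kernel : Type := {x : U | ker_pred x}.

HB.instance Definition _ := [isSub of kernel for @sval U ker_pred].
HB.instance Definition _ := [Choice of kernel by <:].
HB.instance Definition _ :=
  [SubChoice_isSubLmodule of kernel by <:].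

Definition kernel_incl : {linear kernel -> U} := \val.

Definition im_pred : {pred V} := fun y => `[< exists x, f x = y >].

Lemma im_pred_submod : submod_closed im_pred.
Proof.
split=> [|a _ _ /asboolP[x <-] /asboolP[y <-]]; apply/asboolP.
  by exists 0; rewrite raddf0.
by exists (a *: x + y); rewrite linearP.
Qed.

HB.instance Definition _ := GRing.isSubmodClosed.Build R V im_pred
  im_pred_submod.

Definition cokernel : Type := @Quotient.quot V im_pred.

HB.instance Definition _ := GRing.Zmodule.on cokernel.
HB.instance Definition _ := EqQuotient.on cokernel.

Definition coker_scale (a : R) (q : cokernel) : cokernel :=
  \pi_cokernel (a *: repr q).

Lemma coker_piE (x y : V) :
  \pi_cokernel x = \pi_cokernel y <-> exists u, f u = x - y.
Proof.
split=> [/eqP|xy]; first by rewrite -Quotient.idealrBE => /asboolP.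
by apply/eqP; rewrite -Quotient.idealrBE; apply/asboolP.
Qed.

Lemma coker_scale_pi a x : coker_scale a (\pi_cokernel x) = \pi_cokernel (a *: x).
Proof.
apply/coker_piE.
have /coker_piE[u fu] : \pi_cokernel (repr (\pi_cokernel x)) = \pi_cokernel x.
  by rewrite reprK.
by exists (a *: u); rewrite linearZ_LR fu scalerBr.
Qed.

Lemma coker_piD x y : \pi_cokernel (x + y) = \pi_cokernel x + \pi_cokernel y.
Proof. exact: (@Quotient.pi_add V im_pred x y). Qed.

Lemma coker_scalerA a b q :
  coker_scale a (coker_scale b q) = coker_scale (a * b) q.
Proof. by rewrite -[q]reprK (coker_scale_pi b) !coker_scale_pi scalerA. Qed.

Lemma coker_scale1r : left_id 1 coker_scale.
Proof. by move=> q; rewrite -[q]reprK coker_scale_pi scale1r. Qed.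

Lemma coker_scalerDr : right_distributive coker_scale +%R.
Proof.
move=> a p q; rewrite -[p]reprK -[q]reprK.
by rewrite -coker_piD !coker_scale_pi -coker_piD scalerDr.
Qed.

Lemma coker_scalerDl q : {morph coker_scale^~ q : a b / a + b}.
Proof.
by move=> a b; rewrite -[q]reprK !coker_scale_pi -coker_piD scalerDl.
Qed.

HB.instance Definition _ := GRing.Zmodule_isLmodule.Build R cokernel
  coker_scalerA coker_scale1r coker_scalerDr coker_scalerDl.

Definition coker_pi (x : V) : cokernel := \pi_cokernel x.

Lemma coker_pi_is_linear : linear coker_pi.
Proof. by move=> a x y; rewrite /coker_pi coker_piD -coker_scale_pi. Qed.

HB.instance Definition _ := GRing.isLinear.Build R V cokernel *:%R coker_pi
  coker_pi_is_linear.

Definition coker_proj : {linear V -> cokernel} := coker_pi.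

End KerCoker.

(* Predecessor on [int], by cases so that it computes on constructors:
   [Posz n] is n and [Negz n] is - (n + 1). *)
Definition zpred (i : int) : int :=
  match i with
  | Posz 0 => Negz 0
  | Posz n.+1 => Posz n
  | Negz n => Negz n.+1
  end.

Lemma zpredE i : zpred i = i - 1.
Proof.
by case: i => [[|n]|n] //=; rewrite ?NegzE -?opprD -?PoszD ?addn1 // -addn1 PoszD addrK.
Qed.

Record chain_complex (R : pzRingType) := ChainComplex {
  cobj :> int -> lmodType R;
  cdiff : forall i : int, {linear cobj i -> cobj (zpred i)};
  cdiff_diff : forall (i : int) (x : cobj i), cdiff (zpred i) (cdiff i x) = 0
}.

(* Every degree is [zpred i] for a unique i, so this is exactness everywhere. *)
Definition acyclic (R : pzRingType) (C : chain_complex R) : Prop :=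
  forall (i : int) (x : C (zpred i)),
    cdiff C (zpred i) x = 0 -> exists y : C i, cdiff C i y = x.

Record chain_map (R : pzRingType) (C D : chain_complex R) := ChainMap {
  cmap :> forall i : int, {linear C i -> D i};
  cmap_diff : forall (i : int) (x : C i),
    cmap (zpred i) (cdiff C i x) = cdiff D i (cmap i x)
}.

Definition id_map (R : pzRingType) (C : chain_complex R) : chain_map C C :=
  @ChainMap R C C (fun i => idfun) (fun i x => erefl).

Lemma comp_map_diff (R : pzRingType) (C D E : chain_complex R)
    (g : chain_map D E) (f : chain_map C D) (i : int) (x : C i) :
  (g (zpred i) \o f (zpred i)) (cdiff C i x) = cdiff E i ((g i \o f i) x).
Proof. by rewrite /= !cmap_diff. Qed.

Definition comp_map (R : pzRingType) (C D E : chain_complex R)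
    (g : chain_map D E) (f : chain_map C D) : chain_map C E :=
  @ChainMap R C E (fun i => g i \o f i) (comp_map_diff g f).

(* [s i] raises the degree [zpred i] to i; the relation
   f - g = d s + s d is written in degree [zpred i]. *)
Definition homotopic (R : pzRingType) (C D : chain_complex R)
    (f g : chain_map C D) : Prop :=
  exists s : forall i : int, {linear C (zpred i) -> D i},
    forall (i : int) (x : C (zpred i)),
      f (zpred i) x - g (zpred i) x
      = cdiff D i (s i x) + s (zpred i) (cdiff C (zpred i) x).

Definition homotopy_equivalence (R : pzRingType) (C D : chain_complex R)
    (f : chain_map C D) : Prop :=
  exists g : chain_map D C,
    homotopic (comp_map g f) (id_map C) /\ homotopic (comp_map f g) (id_map D).

Definition chain_iso (R : pzRingType) (C D : chain_complex R)
    (f : chain_map C D) : Prop :=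
  exists g : chain_map D C,
    (forall i x, g i (f i x) = x) /\ (forall i y, f i (g i y) = y).

Definition minimal_complex (R : pzRingType) (C : chain_complex R) : Prop :=
  forall f : chain_map C C, homotopy_equivalence f -> chain_iso f.

Record factored_complex (R : pzRingType) (M : lmodType R) := FactoredComplex {
  fcomplex :> chain_complex R;
  feps : {linear fcomplex (Posz 0) -> M};
  feta : {linear M -> fcomplex (Negz 0)};
  feta_eps : forall x : fcomplex (Posz 0),
    cdiff fcomplex (Posz 0) x = feta (feps x)
}.

Definition complete_resolution (R : pzRingType) (M : lmodType R)
    (T : factored_complex M) : Prop :=
  [/\ acyclic T,
      forall i : int, finitely_generated (T i) /\ projective (T i),
      surj (feps T) &
      injective (feta T)].

(* An isomorphism of complete resolutions of M induces the identity of M. *)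
Definition isomorphic_over (R : pzRingType) (M : lmodType R)
    (T T' : factored_complex M) : Prop :=
  exists f : chain_map T T',
    [/\ chain_iso f,
        forall x, feps T' (f (Posz 0) x) = feps T x &
        forall m, f (Negz 0) (feta T m) = feta T' m].

(* [prd n] is the differential of degree n + 1. *)
Record projective_resolution (R : pzRingType) (M : lmodType R) :=
  ProjectiveResolution {
  pr :> nat -> lmodType R;
  prd : forall n : nat, {linear pr n.+1 -> pr n};
  preps : {linear pr 0%N -> M};
  pr_projective : forall n : nat, projective (pr n);
  preps_surj : surj preps;
  preps_exact : forall x, preps x = 0 <-> exists y, prd 0%N y = x;
  pr_exact : forall n (x : pr n.+1),
    prd n x = 0 <-> exists y, prd n.+1 y = x
}.

(* [ir n] sits in homological degree - n, and [ird n] is the differential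
   from degree - n to degree - (n + 1). *)
Record injective_resolution (R : pzRingType) (M : lmodType R) :=
  InjectiveResolution {
  ir :> nat -> lmodType R;
  ird : forall n : nat, {linear ir n -> ir n.+1};
  ireta : {linear M -> ir 0%N};
  ir_injective : forall n : nat, injective_module (ir n);
  ireta_inj : injective ireta;
  ireta_exact : forall x, ird 0%N x = 0 <-> exists m, ireta m = x;
  ir_exact : forall n (x : ir n.+1),
    ird n.+1 x = 0 <-> exists y, ird n y = x
}.

Definition minimal_projective_resolution (R : pzRingType) (M : lmodType R)
    (P : projective_resolution M) : Prop :=
  forall n : nat, projective_cover (coker_proj (prd P n)).

Definition minimal_injective_resolution (R : pzRingType) (M : lmodType R)
    (I : injective_resolution M) : Prop :=
  forall n : nat, injective_envelope (kernel_incl (ird I n)).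

Section Splice.
Variables (R : pzRingType) (M : lmodType R).
Variables (P : projective_resolution M) (I : injective_resolution M).

(* Degree - (n + 1) of the shifted complex is degree - n of I, that is [I n],
   and the shift by -1 negates the differential of I. *)
Definition splice_obj (i : int) : lmodType R :=
  match i with
  | Posz n => P n
  | Negz n => I n
  end.

Definition splice_eta : {linear M -> splice_obj (Negz 0)} := \- ireta I.

Definition splice_diff (i : int) :
    {linear splice_obj i -> splice_obj (zpred i)} :=
  match i return {linear splice_obj i -> splice_obj (zpred i)} with
  | Posz 0 => splice_eta \o preps P
  | Posz n.+1 => prd P n
  | Negz n => \- ird I n
  end.

Lemma splice_diff_diff (i : int) (x : splice_obj i) :
  splice_diff (zpred i) (splice_diff i x) = 0.
Proof.
case: i x => [[|[|n]]|n] x /=.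
- by rewrite raddfN opprK; apply/ireta_exact; exists (preps P x).
- have -> : preps P (prd P 0%N x) = 0 by apply/preps_exact; exists x.
  by rewrite raddf0 oppr0.
- by apply/pr_exact; exists x.
- by rewrite raddfN opprK; apply/ir_exact; exists x.
Qed.

Definition splice_complex : chain_complex R :=
  @ChainComplex R splice_obj splice_diff splice_diff_diff.

Definition splice : factored_complex M :=
  @FactoredComplex R M splice_complex (preps P) splice_eta (fun x => erefl).

End Splice.

(* Main.v *)
Require Import Defs.
From HB Require Import structures.
From mathcomp Require Import all_boot all_algebra falgebra.
From mathcomp Require Import boolp.

(** Let T be minimal.  A family s of maps raising degrees by one makes
    1 - (ds + sd) homotopic to the identity, hence an isomorphism.  If
    N + im d = T_i, projectivity of T_i gives s with (1 - ds)(T_i) inside N,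
    so N = T_i: each T_i is a projective cover of its cokernel.  Dually, the
    T_i are injective because A is self-injective, and if K meets ker d
    trivially then some s satisfies sd = 1 on K, so 1 - sd is injective and
    kills K, whence K = 0.  Thus the two halves of T are minimal resolutions
    of M, and uniqueness of projective covers and injective envelopes gives,
    degree by degree, an isomorphism onto any other splice. *)

Set Implicit Arguments.
Unset Strict Implicit.
Unset Printing Implicit Defensive.

Import GRing.Theory.

Local Open Scope ring_scope.

Definition linear_pack (R : pzRingType) (U V : lmodType R) (f : U -> V)
    (f_lin : linear f) : {linear U -> V} :=
  HB.pack f (GRing.isLinear.Build R U V *:%R f f_lin).

Lemma linear_inverse (R : pzRingType) (U V : lmodType R) (f : {linear U -> V}) :
  injective f -> surj f -> exists g : {linear V -> U}, cancel f g /\ cancel g f.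
Proof.
move=> finj fsurj.
pose g y := projT1 (cid (fsurj y)).
have gK : cancel g f by move=> y; rewrite /g; case: cid.
have glin : linear g by move=> a x y; apply: finj; rewrite linearP !gK.
by exists (linear_pack glin); split=> // x; apply: finj; apply: gK.
Qed.

(** * Lifting, extension, projective covers and injective envelopes *)

Section Modules.
Variable R : pzRingType.
Implicit Types U V N P I X : lmodType R.

Lemma lmod_inj U V (f : {linear U -> V}) :
  (forall x, f x = 0 -> x = 0) -> injective f.
Proof.
move=> f0 x y fxy; apply/eqP; rewrite -subr_eq0; apply/eqP/f0.
by rewrite linearB /= fxy subrr.
Qed.

Lemma linear_inj_eq0 U V (f : {linear U -> V}) x :
  injective f -> f x = 0 <-> x = 0.
Proof.
by move=> finj; split=> [fx|->]; [apply: finj; rewrite fx|]; rewrite raddf0.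
Qed.

Lemma projective_lift P U V (p : {linear U -> V}) (f : {linear P -> V}) :
  projective P -> (forall x, exists u, p u = f x) ->
  exists g : {linear P -> U}, forall x, p (g x) = f x.
Proof.
move=> Pproj fp.
(* The projection of the pullback of f and p to P is onto, hence splits. *)
have dlin : linear (fun z : P * U => f z.1 - p z.2).
  by move=> a [x1 x2] [y1 y2] /=; rewrite !linearP /= scalerDr addrACA.
pose d := linear_pack dlin.
have q1lin : linear (fun z : kernel d => (sval z).1) by [].
have q2lin : linear (fun z : kernel d => (sval z).2) by [].
have q1surj : surj (linear_pack q1lin).
  move=> x; have [u pu] := fp x.
  have dxu : ker_pred d (x, u) by apply/eqP; rewrite /= pu subrr.
  by exists (exist _ (x, u) dxu).
have [s sK] := Pproj _ _ (linear_pack q1lin) idfun q1surj.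
exists (linear_pack q2lin \o s) => x /=.
have /eqP := svalP (s x); rewrite /= => /eqP; rewrite subr_eq0 => /eqP <-.
by have /= -> := sK x.
Qed.

Lemma injective_extend I U V (i : {linear U -> V}) (f : {linear U -> I}) :
  injective_module I -> (forall x, i x = 0 -> f x = 0) ->
  exists g : {linear V -> I}, forall x, g (i x) = f x.
Proof.
move=> Iinj fi.
(* The map from I to the pushout of f and i is injective, hence splits. *)
have dlin : linear (fun u : U => (f u, - i u) : I * V).
  by move=> a x y /=; rewrite !linearP.
pose d := linear_pack dlin.
have j1lin : linear (fun x : I => (x, 0) : I * V).
  by move=> a x y; congr pair; rewrite /= scaler0 addr0.
have j2lin : linear (fun v : V => (0, v) : I * V).
  by move=> a x y; congr pair; rewrite /= scaler0 addr0.
have qinj : injective (coker_proj d \o linear_pack j1lin).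
  move=> x y /coker_piE[u /= [fu iu]].
  have iu0 : i u = 0 by apply: oppr_inj; rewrite iu subr0 oppr0.
  by apply/eqP; rewrite -subr_eq0 -fu fi.
have [r rK] := Iinj _ _ _ idfun qinj.
exists (r \o coker_proj d \o linear_pack j2lin) => u /=.
rewrite -[RHS]rK /=; congr (r _); apply/coker_piE; exists (- u).
by rewrite raddfN /=; congr pair; rewrite /= ?sub0r ?subr0 ?opprK.
Qed.

Definition essential_epi P N (p : {linear P -> N}) : Prop :=
  forall X (h : {linear X -> P}),
    (forall y, exists x, p (h x) = p y) -> surj h.

(** Says that the image of [i] is an essential submodule of [I], so that [i] may again be a
    differential. *)
Definition essential_mono N I (i : {linear N -> I}) : Prop :=
  forall X (h : {linear I -> X}),
    (forall x, h (i x) = 0 -> i x = 0) -> injective h.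

(** The map [p] and the cokernel projection have the same kernel, the image of [d]. *)
Lemma projective_cover_essential U P N (d : {linear U -> P})
    (p : {linear P -> N}) :
  (forall x, p x = 0 <-> exists y, d y = x) ->
  projective_cover (coker_proj d) -> essential_epi p.
Proof.
move=> pd [_ _ cov] X h hp; apply: cov => q.
have [x px] := hp (repr q); exists x.
rewrite -[q]reprK; apply/coker_piE/pd.
by rewrite linearB /= px subrr.
Qed.

Lemma injective_envelope_essential N I V (i : {linear N -> I})
    (d : {linear I -> V}) :
  (forall x, d x = 0 <-> exists m, i m = x) ->
  injective_envelope (kernel_incl d) -> essential_mono i.
Proof.
move=> di [_ _ env] X h hi; apply: env; apply: lmod_inj => z /= hz.
apply: val_inj; have /eqP/di[m im] := svalP z.
by rewrite /= -im; apply: hi; rewrite im.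
Qed.

(** Lifting [p'] through [p] gives [f], which is onto because [p] is essential. A section of [f] is
    onto because [p'] is essential, so [f] is bijective. The last two hypotheses say that [p] and
    [p'] have the same image. *)
Lemma projective_cover_unique P P' N (p : {linear P -> N})
    (p' : {linear P' -> N}) :
  projective P -> projective P' -> essential_epi p -> essential_epi p' ->
  (forall x, exists x', p' x' = p x) -> (forall x', exists x, p x = p' x') ->
  exists f : {linear P' -> P},
    [/\ injective f, surj f & forall x', p (f x') = p' x'].
Proof.
move=> Pproj P'proj ess ess' pp' p'p.
have [f fp] := projective_lift P'proj p'p.
have fsurj : surj f.
  by apply: ess => y; have [x' x'y] := pp' y; exists x'; rewrite fp.
have [g gK] := Pproj _ _ f idfun fsurj.
have gsurj : surj g.
  by apply: ess' => y; exists (f y); rewrite -fp (gK (f y)) fp.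
exists f; split=> // x y; have [u <-] := gsurj x; have [v <-] := gsurj y.
by rewrite !gK /= => ->.
Qed.

(** Dually, [f] extends [i] along [i'] and is injective because [i'] is essential; a retraction of
    [f] is injective because [i] is essential, so [f] is onto. *)
Lemma injective_envelope_unique N I I' (i : {linear N -> I})
    (i' : {linear N -> I'}) :
  injective_module I -> injective_module I' ->
  essential_mono i -> essential_mono i' ->
  (forall x, i x = 0 <-> i' x = 0) ->
  exists f : {linear I' -> I},
    [/\ injective f, surj f & forall x, f (i' x) = i x].
Proof.
move=> Iinj I'inj ess ess' ii'.
have [|f fi] := @injective_extend I _ _ i' i Iinj; first by move=> x /ii'.
have finj : injective f by apply: ess' => x; rewrite fi => /ii'.
have [g gK] := I'inj _ _ f idfun finj.
have ginj : injective g.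
  by apply: ess => x; rewrite -fi gK /= => ->; rewrite raddf0.
by exists f; split=> // y; exists (g y); apply: ginj; rewrite gK.
Qed.

Lemma projective_retract P U (r : {linear P -> U}) (s : {linear U -> P}) :
  cancel s r -> projective P -> projective U.
Proof.
move=> sK Pproj V W p f psurj; have [g gp] := Pproj _ _ p (f \o r) psurj.
by exists (g \o s) => x /=; rewrite gp /= sK.
Qed.

Lemma injective_retract I U (r : {linear I -> U}) (s : {linear U -> I}) :
  cancel s r -> injective_module I -> injective_module U.
Proof.
move=> sK Iinj V W i f iinj; have [g gi] := Iinj _ _ i (s \o f) iinj.
by exists (r \o g) => x /=; rewrite gi /= sK.
Qed.

Lemma injective_ffun (J : finType) I :
  injective_module I -> injective_module ({ffun J -> I} : lmodType R).
Proof.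
move=> Iinj U V i f iinj.
have /choice[g gf] j : exists g : {linear V -> I}, forall x, g (i x) = f x j.
  have flin : linear (fun x => f x j) by move=> a x y; rewrite linearP !ffunE.
  exact: (Iinj _ _ i (linear_pack flin) iinj).
have glin : linear (fun v => [ffun j => g j v]).
  by move=> a x y; apply/ffunP => j; rewrite !ffunE linearP.
by exists (linear_pack glin) => x; apply/ffunP => j; rewrite /= ffunE gf.
Qed.

Lemma finitely_generated_surj U V (f : {linear U -> V}) :
  surj f -> finitely_generated U -> finitely_generated V.
Proof.
move=> fsurj [n [g gen]]; exists n, (f \o g) => y.
have [x <-] := fsurj y; have [a ->] := gen x; exists a.
by rewrite raddf_sum; apply: eq_bigr => i _; rewrite /= linearZ.
Qed.

(** Generators present [P] as a quotient of a finite power of [R]; projectivity splits the quotient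
    map, and a retract of an injective module is injective. *)
Lemma self_injective_projective_injective P :
  self_injective R -> finitely_generated P -> projective P ->
  injective_module P.
Proof.
move=> Rinj [n [g gen]] Pproj.
have plin :
    linear (fun a : {ffun 'I_n -> R^o} => \sum_(i < n) (a i : R) *: g i).
  move=> c x y; rewrite scaler_sumr -big_split; apply: eq_bigr => i _.
  by rewrite !ffunE /= scalerDl scalerA.
have psurj : surj (linear_pack plin).
  move=> x; have [a ->] := gen x; exists [ffun i => a i].
  by apply: eq_bigr => i _; rewrite ffunE.
have [s sK] := Pproj _ _ (linear_pack plin) idfun psurj.
exact: injective_retract sK (injective_ffun Rinj).
Qed.

End Modules.

(** * Minimal complexes and maps homotopic to the identity *)

Lemma zpred_surj i : exists j, i = zpred j.
Proof.
by case: i => [n|[|n]]; [exists (Posz n.+1)|exists (Posz 0)|exists (Negz n)].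
Qed.

Section Minimality.
Variables (R : pzRingType) (C : chain_complex R).

Section Homotopy.
Variable s : forall i, {linear C (zpred i) -> C i}.

Definition homotopy_comp_pred (i : int) : {linear C (zpred i) -> C (zpred i)} :=
  idfun \- ((cdiff C i \o s i) \+ (s (zpred i) \o cdiff C (zpred i))).

(* By cases, so that [homotopy_comp (zpred i)] needs no cast. *)
Definition homotopy_comp (i : int) : {linear C i -> C i} :=
  match i return {linear C i -> C i} with
  | Posz n => homotopy_comp_pred (Posz n.+1)
  | Negz 0 => homotopy_comp_pred (Posz 0)
  | Negz n.+1 => homotopy_comp_pred (Negz n)
  end.

Lemma homotopy_compE i x :
  homotopy_comp (zpred i) x =
  x - (cdiff C i (s i x) + s (zpred i) (cdiff C (zpred i) x)).
Proof. by case: i x => [[|n]|n] x. Qed.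

Lemma homotopy_comp_diff i x :
  homotopy_comp (zpred i) (cdiff C i x) = cdiff C i (homotopy_comp i x).
Proof.
rewrite homotopy_compE cdiff_diff raddf0 addr0.
(* Writing the degree as [zpred j] makes [homotopy_compE] apply on the right as well; both sides
   become [d - dsd]. *)
have [j ij] := zpred_surj i; subst i.
by rewrite homotopy_compE [RHS]linearB [in RHS]linearD /= cdiff_diff add0r.
Qed.

Definition homotopy_map : chain_map C C := ChainMap homotopy_comp_diff.

(** The identity is a homotopy inverse, with homotopy [- s] for both composites. *)
Lemma homotopy_map_equivalence : homotopy_equivalence homotopy_map.
Proof.
exists (id_map C); split; exists (fun i => \- s i) => i x /=;
by rewrite homotopy_compE addrAC subrr sub0r raddfN opprD.
Qed.

Lemma homotopy_comp_bij :
  minimal_complex C ->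
  forall i, injective (homotopy_comp i) /\ surj (homotopy_comp i).
Proof.
move=> /(_ _ homotopy_map_equivalence)[g [fK gK]] i; split.
  exact: can_inj (fK i).
by move=> y; exists (g i y); apply: (gK i).
Qed.

End Homotopy.

(** Concentrated in one degree; the transport [ecast] is forced by types that depend on the
    degree. *)
Definition single_homotopy i0 (s0 : {linear C (zpred i0) -> C i0}) i :
    {linear C (zpred i) -> C i} :=
  match i0 =P i with
  | ReflectT e => ecast j {linear C (zpred j) -> C j} e s0
  | ReflectF _ => \0
  end.

Lemma single_homotopyE i0 s0 : @single_homotopy i0 s0 i0 = s0.
Proof.
(* Equality on [int] is decidable, so [e] is reflexivity and the transport is trivial. *)
by rewrite /single_homotopy; case: eqP => // e; rewrite (eq_axiomK e).
Qed.

Lemma single_homotopy0 i0 s0 i x : i0 <> i -> @single_homotopy i0 s0 i x = 0.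
Proof. by rewrite /single_homotopy; case: eqP. Qed.

Lemma zpred_neq i : zpred i <> i.
Proof.
by rewrite zpredE => /eqP; rewrite -subr_eq0 addrAC subrr.
Qed.

(** At the source of [s0] only [ds] survives: the component starting one degree lower is zero. *)
Lemma homotopy_comp_single_low i s0 x :
  homotopy_comp (@single_homotopy i s0) (zpred i) x = x - cdiff C i (s0 x).
Proof.
rewrite homotopy_compE single_homotopyE single_homotopy0 ?addr0 //.
exact/nesym/zpred_neq.
Qed.

(** At the target of [s0] only [sd] survives: the component starting there is zero. *)
Lemma homotopy_comp_single_high i s0 x :
  homotopy_comp (@single_homotopy i s0) i x = x - s0 (cdiff C i x).
Proof.
have [j ij] := zpred_surj i; subst i; rewrite homotopy_compE single_homotopyE.
rewrite single_homotopy0 ?raddf0 ?add0r //.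
exact: zpred_neq.
Qed.

Lemma minimal_projective_cover i :
  minimal_complex C -> projective (C (zpred i)) ->
  projective_cover (coker_proj (cdiff C i)).
Proof.
move=> Cmin Cproj; split=> // [q|X h hsurj].
  by exists (repr q); apply: reprK.
(* Modulo the image of [h] the differential is onto, so the projection to [cokernel h] lifts through
   it: [x - d (s x)] always lies in the image of [h]. *)
have [|s sP] := @projective_lift _ (C (zpred i)) (C i) (cokernel h)
  (coker_proj h \o cdiff C i) (coker_proj h) Cproj.
  move=> y; have [x /coker_piE[u du]] := hsurj (coker_pi (cdiff C i) y).
  exists (- u); apply/coker_piE; exists (- x).
  by rewrite !linearN /= du opprB addrAC subrr sub0r.
move=> y.
(* Surjectivity of [1 - ds] puts every [y] in that form. *)
have [_ /(_ y)[x <-]] := homotopy_comp_bij (single_homotopy s) Cmin (zpred i).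
rewrite homotopy_comp_single_low.
by have /esym/coker_piE := sP x.
Qed.

Lemma minimal_injective_envelope i :
  minimal_complex C -> injective_module (C i) ->
  injective_envelope (kernel_incl (cdiff C i)).
Proof.
move=> Cmin Cinj; split=> // [|X h hinj]; first exact: val_inj.
(* As [h] is injective on the kernel of [d], [d] is injective on [kernel h]; so the inclusion of
   [kernel h] extends along [d], giving [s (d x) = x] there. *)
have [|s sP] := @injective_extend _ (C i) (kernel h) (C (zpred i))
  (cdiff C i \o kernel_incl h) (kernel_incl h) Cinj.
  move=> x /= /eqP dx; have /eqP hx := svalP x.
  have /(congr1 val) : exist _ (sval x) dx = 0 :> kernel (cdiff C i).
    by apply: hinj; rewrite /= hx raddf0.
  by [].
apply: lmod_inj => x /eqP hx.
(* The injective map [1 - sd] vanishes on [kernel h]. *)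
have [finj _] := homotopy_comp_bij (single_homotopy s) Cmin i.
apply: finj; rewrite raddf0 homotopy_comp_single_high.
by have /= -> := sP (exist _ x hx); rewrite subrr.
Qed.

End Minimality.

(** * Isomorphisms of complexes and transport of completeness *)

Lemma chain_iso_bij (R : pzRingType) (C D : chain_complex R)
    (f : chain_map C D) :
  (forall i, injective (f i) /\ surj (f i)) -> chain_iso f.
Proof.
move=> fbij.
have /cid[g gP] : exists g : forall i, {linear D i -> C i},
    forall i, cancel (f i) (g i) /\ cancel (g i) (f i).
  have H i := cid (linear_inverse (fbij i).1 (fbij i).2).
  by exists (fun i => projT1 (H i)) => i; apply: (projT2 (H i)).
have gd i x : g (zpred i) (cdiff D i x) = cdiff C i (g i x).
  by apply: (fbij (zpred i)).1; rewrite cmap_diff !(gP _).2.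
by exists (ChainMap gd); split=> i; [apply: (gP i).1|apply: (gP i).2].
Qed.

(** Makes completeness of a splice a consequence of its isomorphism with a given complete
    resolution. *)
Lemma complete_resolution_iso (R : pzRingType) (M : lmodType R)
    (T T' : factored_complex M) :
  isomorphic_over T T' -> complete_resolution T -> complete_resolution T'.
Proof.
move=> [f [[g [fK gK]] feE fnE]] [Tac Tfgp esurj einj]; split.
- move=> i x dx; have [|y dy] := Tac i (g _ x).
    by rewrite -cmap_diff dx raddf0.
  by exists (f i y); rewrite -cmap_diff dy gK.
- move=> i; have [Tfg Tproj] := Tfgp i; split.
    by apply: (finitely_generated_surj (f := f i)) => // y; exists (g i y).
  exact: projective_retract (gK i) Tproj.
- by move=> m; have [x <-] := esurj m; exists (f 0 x); rewrite feE.
- by move=> x y; rewrite -!fnE => /(can_inj (fK (Negz 0)))/einj.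
Qed.

(** * The two halves of a complete resolution *)

Section Halves.
Variables (R : pzRingType) (M : lmodType R) (T : factored_complex M).
Hypothesis T_complete : complete_resolution T.

Let T_acyclic : acyclic T. Proof. by case: T_complete. Qed.
Let T_proj i : projective (T i).
Proof. by case: T_complete => _ /(_ i)[]. Qed.
Let eps_surj : surj (feps T). Proof. by case: T_complete. Qed.
Let eta_inj : injective (feta T). Proof. by case: T_complete. Qed.

Lemma complete_exact i x :
  cdiff T (zpred i) x = 0 <-> exists y, cdiff T i y = x.
Proof.
by split=> [/T_acyclic//|[y <-]]; apply: cdiff_diff.
Qed.

(** The kernel of [feps T] is that of the degree 0 differential, because [feta T] is injective. *)
Lemma complete_eps_exact x :
  feps T x = 0 <-> exists y, cdiff T (Posz 1) y = x.
Proof.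
split=> [ex|/complete_exact dx].
  by apply/complete_exact; rewrite feta_eps ex raddf0.
by apply: eta_inj; rewrite -feta_eps [RHS]raddf0; exact: dx.
Qed.

(** The image of [feta T] is that of the degree 0 differential, because [feps T] is onto. *)
Lemma complete_eta_exact x :
  cdiff T (Negz 0) x = 0 <-> exists m, feta T m = x.
Proof.
split=> [/(complete_exact (i := Posz 0))[y <-]|[m <-]].
  by exists (feps T y); rewrite feta_eps.
have [y <-] := eps_surj m; rewrite -feta_eps.
exact: (cdiff_diff (i := Posz 0)).
Qed.

Definition nonneg_half : projective_resolution M :=
  @ProjectiveResolution R M (fun n => T (Posz n))
    (fun n => cdiff T (Posz n.+1)) (feps T) (fun n => @T_proj (Posz n))
    eps_surj complete_eps_exact (fun n => @complete_exact (Posz n.+2)).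

(** Term [n] is [T] in degree - (n + 1), with the differentials of [T] unchanged; the signs of the
    shift are treated only in the comparison with the splice. *)
Definition neg_half (T_inj : forall i, injective_module (T i)) :
    injective_resolution M :=
  @InjectiveResolution R M (fun n => T (Negz n))
    (fun n => cdiff T (Negz n)) (feta T) (fun n => T_inj (Negz n))
    eta_inj complete_eta_exact (fun n => @complete_exact (Negz n)).

Hypothesis T_minimal : minimal_complex T.

Lemma nonneg_half_minimal : minimal_projective_resolution nonneg_half.
Proof.
by move=> n; apply: (@minimal_projective_cover _ _ (Posz n.+1)).
Qed.

Lemma neg_half_minimal T_inj : minimal_injective_resolution (neg_half T_inj).
Proof. by move=> n; apply: minimal_injective_envelope. Qed.

End Halves.

(** * Uniqueness of minimal resolutions, by recursion on the degree *)

Lemma dependent_choice_seq (S : nat -> Type)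
    (E : forall n, S n -> S n.+1 -> Prop) (s0 : S 0%N) :
  (forall n s, exists s', E n s s') ->
  exists s : forall n, S n, s 0%N = s0 /\ forall n, E n (s n) (s n.+1).
Proof.
move=> step; pose next n s := projT1 (cid (step n s)).
exists (nat_rect S s0 next); split=> // n /=.
exact: (projT2 (cid (step n _))).
Qed.

(** Once [f n] matches the images of the incoming differentials, [prd P n] and [f n \o prd P' n] are
    essential maps from projectives with the same image, so uniqueness of covers yields [f n.+1]. *)
Lemma minimal_projective_resolution_unique (R : pzRingType) (M : lmodType R)
    (P P' : projective_resolution M) :
  minimal_projective_resolution P -> minimal_projective_resolution P' ->
  exists f : forall n, {linear P' n -> P n},
    [/\ forall n, injective (f n) /\ surj (f n),
        forall x, preps P (f 0%N x) = preps P' x &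
        forall n x, prd P n (f n.+1 x) = f n (prd P' n x)].
Proof.
move=> Pmin P'min.
pose inv n (f : {linear P' n -> P n}) :=
  [/\ injective f, surj f &
      forall x, (exists y, prd P' n y = x) <-> exists y, prd P n y = f x].
have [f0 [f0inj f0surj f0E]] : exists f : {linear P' 0%N -> P 0%N},
    [/\ injective f, surj f & forall x, preps P (f x) = preps P' x].
  apply: projective_cover_unique; try exact: pr_projective.
  - exact: projective_cover_essential (@preps_exact _ _ P) (Pmin 0%N).
  - exact: projective_cover_essential (@preps_exact _ _ P') (P'min 0%N).
  - by move=> x; apply: preps_surj.
  - by move=> x; apply: preps_surj.
(* By exactness these images are the kernels of the augmentations. *)
have f0inv : inv 0%N f0.
  by split=> // x; rewrite -!preps_exact f0E.
have step n (s : {f | @inv n f}) : exists s' : {f | @inv n.+1 f},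
    forall x, prd P n (sval s' x) = sval s (prd P' n x).
  case: s => f [finj fsurj fim] /=.
  have [||||x|x|g [ginj gsurj gE]] :=
    projective_cover_unique (p := prd P n) (p' := f \o prd P' n).
  - exact: pr_projective.
  - exact: pr_projective.
  - exact: projective_cover_essential (@pr_exact _ _ P n) (Pmin n.+1).
  - apply: projective_cover_essential (P'min n.+1) => x.
    by rewrite -pr_exact; exact: (linear_inj_eq0 _ finj).
  - have [u fu] := fsurj (prd P n x).
    by have [|y yu] := (fim u).2; [exists x|exists y; rewrite /= yu].
  - by have [|y yu] := (fim (prd P' n x)).1; [exists x|exists y].
  suff ginv : inv n.+1 g by exists (exist _ g ginv).
  (* The images of the next differentials are the kernels of the current ones, which [g] matches
     because [f] is injective. *)
  split=> // x; rewrite -!pr_exact gE.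
  exact: (iff_sym (linear_inj_eq0 _ finj)).
have [s [s0 sE]] := dependent_choice_seq (exist _ f0 f0inv) step.
exists (fun n => sval (s n)); split=> //.
- by move=> n; case: (svalP (s n)).
- by rewrite s0.
Qed.

(** Dually, once [f n] matches the kernels of the outgoing differentials, [ird I n \o f n] and
    [ird I' n] have the same kernel and essential images in injectives, so uniqueness of envelopes
    yields [f n.+1]. *)
Lemma minimal_injective_resolution_unique (R : pzRingType) (M : lmodType R)
    (I I' : injective_resolution M) :
  minimal_injective_resolution I -> minimal_injective_resolution I' ->
  exists f : forall n, {linear I' n -> I n},
    [/\ forall n, injective (f n) /\ surj (f n),
        forall m, f 0%N (ireta I' m) = ireta I m &
        forall n x, ird I n (f n x) = f n.+1 (ird I' n x)].
Proof.
move=> Imin I'min.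
pose inv n (f : {linear I' n -> I n}) :=
  [/\ injective f, surj f & forall x, ird I' n x = 0 <-> ird I n (f x) = 0].
have [f0 [f0inj f0surj f0E]] : exists f : {linear I' 0%N -> I 0%N},
    [/\ injective f, surj f & forall m, f (ireta I' m) = ireta I m].
  apply: injective_envelope_unique; try exact: ir_injective.
  - exact: injective_envelope_essential (@ireta_exact _ _ I) (Imin 0%N).
  - exact: injective_envelope_essential (@ireta_exact _ _ I') (I'min 0%N).
  - move=> m; apply: (iff_trans (linear_inj_eq0 _ (@ireta_inj _ _ I))).
    exact: (iff_sym (linear_inj_eq0 _ (@ireta_inj _ _ I'))).
have f0inv : inv 0%N f0.
  split=> // x; rewrite !ireta_exact.
  by split=> -[m]; [move=> <-|rewrite -f0E => /f0inj]; exists m.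
have step n (s : {f | @inv n f}) : exists s' : {f | @inv n.+1 f},
    forall x, ird I n (sval s x) = sval s' (ird I' n x).
  case: s => f [finj fsurj fim] /=.
  have [||||x|g [ginj gsurj gE]] :=
    injective_envelope_unique (i := ird I n \o f) (i' := ird I' n).
  - exact: ir_injective.
  - exact: ir_injective.
  (* Since [f] is onto, precomposing with it leaves the image of [ird I n] unchanged. *)
  - apply: injective_envelope_essential (Imin n.+1) => x.
    rewrite ir_exact /=; split=> -[y <-]; last by exists (f y).
    by have [u <-] := fsurj y; exists u.
  - exact: injective_envelope_essential (@ir_exact _ _ I' n) (I'min n.+1).
  - exact: iff_sym (fim x).
  suff ginv : inv n.+1 g by exists (exist _ g ginv).
  (* The new kernels are the images of the previous differentials; [gE], with [f] onto and [g]
     injective, matches these. *)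
  split=> // x; rewrite !ir_exact; split=> -[y].
    by move=> <-; exists (f y); rewrite gE.
  by have [u <-] := fsurj y; have /= <- := gE u => /ginj; exists u.
have [s [s0 sE]] := dependent_choice_seq (exist _ f0 f0inv) step.
exists (fun n => sval (s n)); split=> //.
- by move=> n; case: (svalP (s n)).
- by rewrite s0.
Qed.

(** * Comparison of a minimal complete resolution with the splice *)

Lemma minimal_complete_splice (R : pzRingType) (M : lmodType R)
    (T : factored_complex M) (P : projective_resolution M)
    (I : injective_resolution M) :
  complete_resolution T -> (forall i, injective_module (T i)) ->
  minimal_complex T -> minimal_projective_resolution P ->
  minimal_injective_resolution I -> isomorphic_over T (splice P I).
Proof.
move=> Tc Ti Tm Pmin Imin.
have [f [fbij feps fd]] :=
  minimal_projective_resolution_unique Pmin (nonneg_half_minimal Tc Tm).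
have [g [gbij geta gd]] :=
  minimal_injective_resolution_unique Imin (neg_half_minimal Tc Tm Ti).
(* [h] carries the sign (-1)^(n+1): the splice negates its coaugmentation as
   well as all its differentials in negative degrees. *)
pose h n : {linear T (Negz n) -> I n} := if odd n then g n else \- g n.
have h0 m : h 0%N (feta T m) = - ireta I m by rewrite /h /= geta.
have hd n x : h n.+1 (cdiff T (Negz n) x) = - ird I n (h n x).
  rewrite /h /=; case: (odd n) => /=; first by rewrite gd.
  by rewrite linearN /= opprK gd.
have hbij n : injective (h n) /\ surj (h n).
  rewrite /h; have [ginj gsurj] := gbij n; case: (odd n) => //; split.
    by move=> x y /= /oppr_inj/ginj.
  by move=> y; have [x gx] := gsurj (- y); exists x; rewrite /= gx opprK.
pose F (i : int) : {linear T i -> splice P I i} :=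
  match i with Posz n => f n | Negz n => h n end.
have Fd i x : F (zpred i) (cdiff T i x) = cdiff (splice P I) i (F i x).
  (* In degree 0 both differentials factor through [M], and the sign in [h0] is that of
     [splice_eta]. *)
  case: i x => [[|n]|n] x /=; last exact: hd.
    by rewrite feta_eps [LHS]h0 feps.
  by rewrite fd.
exists (ChainMap Fd); split=> //.
by apply: chain_iso_bij => -[n|n]; [apply: fbij|apply: hbij].
Qed.

Theorem corollary2p5 (k : fieldType) (A : falgType k) (M : lmodType A)
    (A_self_injective : self_injective A)
    (M_fg : finitely_generated M)
    (T : factored_complex M)
    (T_complete : complete_resolution T)
    (T_minimal : minimal_complex T) :
  (exists (P : projective_resolution M) (I : injective_resolution M),
     minimal_projective_resolution P /\ minimal_injective_resolution I) /\
  (forall (P : projective_resolution M) (I : injective_resolution M),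
     minimal_projective_resolution P -> minimal_injective_resolution I ->
     complete_resolution (splice P I) /\ isomorphic_over T (splice P I)).
Proof.
(* Self-injectivity of [A] enters here, each [T i] being finitely generated projective. *)
have T_inj i : injective_module (T i).
  have [_ /(_ i)[Tfg Tproj] _ _] := T_complete.
  exact: self_injective_projective_injective.
split.
  (* Existence is witnessed by [T] itself, cut at [M]. *)
  exists (nonneg_half T_complete), (neg_half T_complete T_inj).
  by split; [apply: nonneg_half_minimal|apply: neg_half_minimal].
move=> P I Pmin Imin.
have TPI := minimal_complete_splice T_complete T_inj T_minimal Pmin Imin.
by split=> //; apply: complete_resolution_iso TPI T_complete.
Qed.
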